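(* Let $d=2$ and let $\mathbf{p}_1,\dots,\mathbf{p}_n$ be independent points uniformly distributed on the $1$-dimensional simplex $\{(x_1,x_2): x_1,x_2\ge0,\ x_1+x_2=1\}$. Then the expected number of comparisons used by algorithm Maxima (described in the context) on input $(\mathbf{p}_1,\dots,\mathbf{p}_n)$ is $O(n\log n)$.
   Context: For $\mathbf{p},\mathbf{q}\in\mathbb{R}^d$, $\mathbf{q}\prec\mathbf{p}$ ($\mathbf{p}$ dominates $\mathbf{q}$) means all coordinates of $\mathbf{p}-\mathbf{q}$ are nonnegative and $\mathbf{p}\ne\mathbf{q}$; maxima of a set are its non-dominated points. A $k$-d tree stores points in a binary tree where a node at depth $t$ (root at depth $0$) uses coordinate $\ell=(t\bmod d)+1$ as discriminator: a point $\mathbf{p}$ inserted below a node $\mathbf{r}$ with discriminator $\ell$ goes to the right subtree if $p_\ell\ge r_\ell$ and to the left subtree otherwise, becoming a new leaf when the relevant subtree is empty. Each node $\mathbf{r}$ stores the upper bound $\mathbf{u}_{\mathbf{r}}$, the coordinatewise maximum of all points in its subtree (updated along the insertion path on each insertion). The test Dominated$(\mathbf{r},\mathbf{p})$ returns 1 if $\mathbf{p}\prec\mathbf{r}$; otherwise, if $\mathbf{r}$ has a left child $\mathbf{r}_L$ with $\mathbf{p}\prec\mathbf{u}_{\mathbf{r}_L}$ and Dominated$(\mathbf{r}_L,\mathbf{p})=1$ it returns 1; otherwise, if $\mathbf{r}$ has a right child $\mathbf{r}_R$ with $\mathbf{p}\prec\mathbf{u}_{\mathbf{r}_R}$ and Dominated$(\mathbf{r}_R,\mathbf{p})=1$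 it returns 1; otherwise it returns 0. Algorithm Maxima: Phase 1: start a $k$-d tree with root $\mathbf{p}_1$ and list $R=(\mathbf{p}_1)$; for $i=2,\dots,n$, if Dominated(root, $\mathbf{p}_i$)$=0$, insert $\mathbf{p}_i$ into the tree and append it to $R$. Phase 2: with $R=(\mathbf{q}_1,\dots,\mathbf{q}_k)$, discard the tree, start a new $k$-d tree with root $\mathbf{q}_k$, and for $i=k-1$ down to $1$ insert $\mathbf{q}_i$ if Dominated(root, $\mathbf{q}_i$)$=0$; the final tree holds the maxima. Comparisons counted are comparisons between points/coordinates performed in the tests Dominated and in insertions. *)

(* Defs.v *)
From HB Require Import structures.
From mathcomp Require Import all_boot all_order all_algebra.
From mathcomp Require Import all_classical all_reals all_analysis.

Set Implicit Arguments.
Unset Strict Implicit.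
Unset Printing Implicit Defensive.

Import Order.TTheory GRing.Theory Num.Theory.
Import numFieldNormedType.Exports.

Local Open Scope classical_set_scope.
Local Open Scope ring_scope.

Section KdTreeMaxima.
Context {R : realDomainType} {d : nat}.
Local Notation point := (d.-tuple R).

Definition prec (q p : point) : bool :=
  [forall i, tnth q i <= tnth p i] && (p != q).

Definition coord_max (p q : point) : point :=
  [tuple Num.max (tnth p i) (tnth q i) | i < d].

(* [KdNode r u l r'] : point [r], stored upper bound [u], left subtree [l] and
   right subtree [r'] *)
Inductive kdtree :=
  | KdEmpty
  | KdNode of point & point & kdtree & kdtree.

Definition kdleaf (p : point) : kdtree := KdNode p p KdEmpty KdEmpty.

(* Comparison counts are in (three-way) comparisons of two coordinates: a
   dominance test between two points costs [d], the discriminator test at a node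
   costs 1, and the coordinatewise maximum that updates an upper bound costs
   [d]. Every function below returns its result paired with its count. *)

(* What the test spends on a child [t], given [rec], the outcome of the
   recursive call on [t]; [rec], and its count, is used only when [p] is
   dominated by the upper bound stored at [t]. *)
Definition child_dominated (p : point) (t : kdtree) (rec : bool * nat) :
    bool * nat :=
  if t is KdNode _ u _ _ then
    if prec p u then (rec.1, d + rec.2)%N else (false, d)
  else (false, 0%N).

Fixpoint dominated (t : kdtree) (p : point) : bool * nat :=
  if t is KdNode r _ tl tr then
    if prec p r then (true, d) else
    let: (bl, cl) := child_dominated p tl (dominated tl p) in
    if bl then (true, d + cl)%N else
    let: (br, cr) := child_dominated p tr (dominated tr p) in
    (br, d + cl + cr)%N
  else (false, 0%N).

(* [k] is the depth of the root of [t] in the whole tree; coordinates are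
   numbered from 0, so the discriminator at depth [k] is [k %% d]. *)
Fixpoint kd_insert (k : nat) (t : kdtree) (p : point) : kdtree * nat :=
  if t is KdNode r u tl tr then
    if nth 0 r (k %% d)%N <= nth 0 p (k %% d)%N then
      let: (tr', c) := kd_insert k.+1 tr p in
      (KdNode r (coord_max u p) tl tr', 1 + d + c)%N
    else
      let: (tl', c) := kd_insert k.+1 tl p in
      (KdNode r (coord_max u p) tl' tr, 1 + d + c)%N
  else (kdleaf p, 0%N).

(* State: current tree, list of the inserted points in insertion order, number
   of comparisons so far. *)
Definition phase_step (st : kdtree * seq point * nat) (p : point) :
    kdtree * seq point * nat :=
  let: (t, s, c) := st in
  let: (b, c1) := dominated t p in
  if b then (t, s, c + c1)%N else
  let: (t', c2) := kd_insert 0 t p in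
  (t', rcons s p, c + c1 + c2)%N.

Definition phase (ps : seq point) : kdtree * seq point * nat :=
  if ps is p :: ps' then foldl phase_step (kdleaf p, [:: p], 0%N) ps'
  else (KdEmpty, [::], 0%N).

(* The second phase is the first one run on the reversed list of survivors. *)
Definition maxima (ps : seq point) : kdtree * nat :=
  let: (_, qs, c1) := phase ps in
  let: (t, _, c2) := phase (rev qs) in
  (t, c1 + c2)%N.

Definition maxima_comparisons (ps : seq point) : nat := (maxima ps).2.

End KdTreeMaxima.

Definition mutually_independent d d' (T : measurableType d)
    (U : measurableType d') (R : realType) (P : probability T R)
    (I : finType) (X : I -> {RV P >-> U}) : Prop :=
  forall (J : {set I}) (A : I -> set U),
    (forall i, i \in J -> measurable (A i)) ->
    P (\bigcap_(i in [set` J]) (X i @^-1` A i)) =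
    (\prod_(i in J) P (X i @^-1` A i))%E.

Section UniformSimplex.
Context {R : realType}.

Definition simplex1 : set (2.-tuple R) :=
  [set p | [/\ 0 <= tnth p 0, 0 <= tnth p 1 & tnth p 0 + tnth p 1 = 1]].

Definition simplex1_param (x : R) : 2.-tuple R := [tuple x; 1 - x].

Lemma simplex1_paramE : simplex1_param @` `[0, 1] = simplex1.
Proof.
apply/seteqP; split => [_ [x + <-]|p [p0 p1 p01]].
  rewrite /= in_itv /= => /andP[x0 x1].
  by split; rewrite !(tnth_nth 0) /= ?subr_ge0 // addrC subrK.
exists (tnth p 0); first by rewrite /= in_itv /= p0 -p01 lerDl.
apply: eq_from_tnth => i; rewrite (tnth_nth 0).
case: i => [[|[|m]] Hi] //=; first by congr tnth; apply/val_inj.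
by rewrite -p01 addrAC subrr add0r; congr tnth; apply/val_inj.
Qed.

(* [simplex1_param] is an affine bijection from the unit interval onto the
   segment [simplex1], so it carries the uniform law of the unit interval to
   normalized arc length. *)
Definition uniform_simplex1 : set (2.-tuple R) -> \bar R :=
  pushforward (uniform_prob (@ltr01 R)) simplex1_param.

Definition uniform_on_simplex1 d (T : measurableType d) (P : probability T R)
    (X : {RV P >-> 2.-tuple R}) : Prop :=
  forall A : set (2.-tuple R), measurable A ->
    distribution P X A = uniform_simplex1 A.

End UniformSimplex.

(* Main.v *)
(* On the line x + y = 1 no point dominates another and the second coordinate
   decreases with the first, so every point survives and the kd-tree is a binary
   search tree on first coordinates. A dominance test follows only the insertion
   path of the point, hence the number of comparisons is linear in the number of
   (ancestor, descendant) pairs of the two trees. The j-th point is an ancestor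
   of a later point p only if it is the nearest to p, from above or from below,
   among the first j points. By exchangeability this has probability at most
   2 / j, and summing gives n times a harmonic sum. *)
Require Import Defs.
From HB Require Import structures.
From mathcomp Require Import all_boot all_order all_algebra.
From mathcomp Require Import all_classical all_reals all_analysis.
From mathcomp Require Import fingroup perm measurable_realfun zify lra.

Set Implicit Arguments.
Unset Strict Implicit.
Unset Printing Implicit Defensive.

Import Order.TTheory GRing.Theory Num.Theory.
Import numFieldNormedType.Exports.

Local Open Scope classical_set_scope.
Local Open Scope ring_scope.

Local Notation key p := (tnth p (0%R : 'I_2)).

(** * General k-d trees: search paths, insertion costs and the ordering invariant *)

Section Tree.
Context {R : realDomainType} {d : nat}.
Local Notation point := (d.-tuple R).
Implicit Types (p q r u : point) (t : @kdtree R d) (k : nat).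

Definition goes_right k r p : bool := nth 0 r (k %% d)%N <= nth 0 p (k %% d)%N.

Fixpoint kd_points t : seq point :=
  if t is KdNode r _ tl tr then r :: kd_points tl ++ kd_points tr else [::].

Fixpoint kd_depth k t p : nat :=
  if t is KdNode r _ tl tr then
    (if goes_right k r p then kd_depth k.+1 tr p else kd_depth k.+1 tl p).+1
  else 0%N.

(* Of the stored upper bound only "at most the maximum of the subtree" matters:
   it makes a dominance test fail outside the range of the subtree. *)
Fixpoint kd_wf k t : Prop :=
  if t is KdNode r u tl tr then
    [/\ {in kd_points tl, forall q, ~~ goes_right k r q},
        {in kd_points tr, forall q, goes_right k r q},
        forall i, exists2 m, m \in kd_points t & tnth u i <= tnth m i,
        kd_wf k.+1 tl & kd_wf k.+1 tr]
  else True.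

Lemma mem_kd_insert k t p : kd_points (kd_insert k t p).1 =i p :: kd_points t.
Proof.
elim: t k => [|r u tl IHl tr IHr] k q //=; case: ifP => _.
  move: (IHr k.+1 q); case: kd_insert => t' c /= IH.
  by rewrite !inE !mem_cat IH !inE; do !case: (_ == _); rewrite ?orbT.
move: (IHl k.+1 q); case: kd_insert => t' c /= IH.
by rewrite !inE !mem_cat IH !inE; do !case: (_ == _); rewrite ?orbT.
Qed.

(** Each node on the path costs one discriminator test and [d] comparisons for its upper bound. *)
Lemma kd_insert_cost k t p : (kd_insert k t p).2 = (d.+1 * kd_depth k t p)%N.
Proof.
elim: t k => [|r u tl IHl tr IHr] k /=; first by rewrite muln0.
rewrite /goes_right; case: ifP => _.
  by move: (IHr k.+1); case: kd_insert => t' c /= ->; rewrite mulnS.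
by move: (IHl k.+1); case: kd_insert => t' c /= ->; rewrite mulnS.
Qed.

Lemma kd_insert_wf k t p : kd_wf k t -> kd_wf k (kd_insert k t p).1.
Proof.
(* Each coordinate of the raised bound is witnessed by the old witness or by the new point. *)
have hmax r' u (s : seq point) (s' : seq point) : s' =i p :: s ->
    (forall i, exists2 m, m \in r' :: s & tnth u i <= tnth m i) ->
    forall i, exists2 m, m \in r' :: s' & tnth (coord_max u p) i <= tnth m i.
  move=> ss' hu i; rewrite tnth_mktuple; have [m ms um] := hu i.
  case: (leP (tnth u i) (tnth p i)) => up.
    by exists p => //; rewrite inE ss' mem_head orbT.
  exists m => //; move: ms; rewrite !inE ss' inE.
  by case/orP => ->; rewrite ?orbT.
elim: t k => [|r u tl IHl tr IHr] k /=.
  by move=> _; split => // i; exists p => //; rewrite mem_head.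
case=> wl wr wu wfl wfr; case: ifP => rp.
  move: (IHr _ wfr) (mem_kd_insert k.+1 tr p).
  case: kd_insert => t' c /= wt' mt'.
  split => //; first by move=> q; rewrite mt' inE => /predU1P[->//|]; exact: wr.
  apply: hmax wu => q; rewrite mem_cat mt' !inE mem_cat.
  by do !case: (_ == _); rewrite ?orbT.
move: (IHl _ wfl) (mem_kd_insert k.+1 tl p).
case: kd_insert => t' c /= wt' mt'.
split => //.
  by move=> q; rewrite mt' inE => /predU1P[->|]; [exact/negbT|exact: wl].
apply: hmax wu => q; rewrite mem_cat mt' !inE mem_cat.
by do !case: (_ == _); rewrite ?orbT.
Qed.

(** Insertion without any dominance test: the tree a phase produces when no point is ever
    rejected. *)
Definition kd_build (s : seq point) : @kdtree R d :=
  foldl (fun t p => (kd_insert 0 t p).1) KdEmpty s.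

Lemma kd_build_rcons s p :
  kd_build (rcons s p) = (kd_insert 0 (kd_build s) p).1.
Proof. by rewrite /kd_build foldl_rcons. Qed.

Lemma kd_build_wf s : kd_wf 0 (kd_build s).
Proof.
by elim/last_ind: s => // s p IH; rewrite kd_build_rcons; exact: kd_insert_wf.
Qed.

Lemma mem_kd_build s : kd_points (kd_build s) =i s.
Proof.
elim/last_ind: s => // s p IH q.
by rewrite kd_build_rcons mem_kd_insert mem_rcons !inE IH.
Qed.

End Tree.

(** * Deterministic cost of the algorithm on the line x + y = 1 *)

Section Line.
Context {R : realDomainType}.
Local Notation point := (2.-tuple R).
Implicit Types (p q r u : point) (t : @kdtree R 2) (k : nat) (s : seq point).

Definition on_line p : bool := key p + tnth p 1 == 1.

(** The second coordinate is 1 minus the key, so odd depths branch on the reversed order of keys;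
    ties go right at every depth. *)
Lemma goes_rightE k r p : on_line r -> on_line p ->
  goes_right k r p =
  if odd k then key p <= key r else key r <= key p.
Proof.
rewrite /on_line => /eqP r1 /eqP p1; rewrite /goes_right modn2.
have nth1 q : nth 0 q 1%N = tnth q 1 by rewrite (tnth_nth 0).
have nth0 q : nth 0 q 0%N = key q by rewrite (tnth_nth 0).
case: (odd k); rewrite ?nth1 ?nth0 //.
by apply/idP/idP; lra.
Qed.

Lemma prec_coord p q : prec p q -> key p <= key q /\ tnth p 1 <= tnth q 1.
Proof. by case/andP => /forallP h _; split. Qed.

Lemma on_line_prec p q : on_line p -> on_line q -> ~~ prec p q.
Proof.
rewrite /on_line => /eqP p1 /eqP q1; apply/negP => pq.
have [h0 h1] := prec_coord pq; case/andP: pq => _ /eqP; apply.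
apply: eq_from_tnth => i; have [->|->] : i = 0 \/ i = 1; last 2 first.
- by lra.
- by lra.
by case: i => [[|[|//]] ?]; [left|right]; exact/val_inj.
Qed.

Definition strictly_between (a b x : R) := (a < x < b) || (b < x < a).

(** The path of [p] grows only if [q] becomes the leaf at its end. A stored key strictly between
    those of [p] and [q] prevents this: as long as they branch alike it follows them, and at its
    node at the latest they part. *)
Lemma kd_depth_insert k t p q : kd_wf k t ->
  all on_line (kd_points t) -> on_line p -> on_line q ->
  (kd_depth k (kd_insert k t q).1 p <= kd_depth k t p +
     ~~ has (fun r => strictly_between (key q) (key p) (key r))
          (kd_points t))%N.
Proof.
move=> wt ot op oq.
elim: t k wt ot => [|r u tl IHl tr IHr] k /=; first by case: goes_right.
case=> wl wr _ wfl wfr /andP[or]; rewrite all_cat => /andP[ol orr].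
rewrite -/(goes_right k r q) has_cat.
(* When [p] and [q] branch alike, the other subtree lies beyond [r] and holds no key between
   theirs. *)
have skip (s : seq point) b : all on_line s -> goes_right k r p = b ->
    goes_right k r q = b -> {in s, forall x, goes_right k r x = ~~ b} ->
    has (fun x => strictly_between (key q) (key p) (key x)) s = false.
  move=> os rp rq sb; apply/hasPn => x xs; have ox := allP os _ xs.
  have := sb x xs; move: rp rq; rewrite !goes_rightE // /strictly_between.
  by case: (odd k); case: b {sb} => /= h1 h2 h3; lra.
case: (boolP (goes_right k r q)) => rq.
  have := IHr _ wfr orr; case: kd_insert => t' c /= IH.
  case: ifP => rp; last by lia.
  rewrite (skip _ true ol rp rq); last by move=> x /wl/negbTE.
  suff -> : strictly_between (key q) (key p) (key r) = false by lia.
  by move: rp rq; rewrite !goes_rightE // /strictly_between; case: odd; lra.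
have := IHl _ wfl ol; case: kd_insert => t' c /= IH.
case: ifP => rp; first by lia.
rewrite (skip _ false orr rp (negbTE rq) wr) orbF.
suff -> : strictly_between (key q) (key p) (key r) = false by lia.
by move: rp rq; rewrite !goes_rightE // /strictly_between; case: odd; lra.
Qed.

(* On the line an upper bound dominates only the points between the extreme
   keys of its subtree, so the test descends only along the insertion path. *)
Lemma dominated_on_line k t p : kd_wf k t -> all on_line (kd_points t) ->
  on_line p ->
  (dominated t p).1 = false /\ ((dominated t p).2 <= 6 * kd_depth k t p)%N.
Proof.
move=> wt ot op; elim: t k wt ot => [|r u tl IHl tr IHr] k //=.
case=> wl wr _ wfl wfr /andP[or]; rewrite all_cat => /andP[ol orr].
rewrite (negbTE (on_line_prec op or)).
have away t' b k' : kd_wf k' t' -> all on_line (kd_points t') ->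
    {in kd_points t', forall q, goes_right k r q = ~~ b} ->
    goes_right k r p = b ->
    child_dominated p t' (dominated t' p) =
      (false, if t' is KdEmpty then 0 else 2)%N.
  case: t' => // r' u' tl' tr' [_ _ wu _ _] ot' sb rp.
  rewrite /child_dominated ifF //; apply/negP => pu.
  (* The two coordinates of the bound give points [m] and [m'] of the subtree with key of [m'] <=
     key of [p] <= key of [m]; but both lie across [r] from [p]. *)
  have [h0 h1] := prec_coord pu.
  have [m mt um] := wu 0; have [m' mt' um'] := wu 1.
  have om := allP ot' _ mt; have om' := allP ot' _ mt'.
  have := sb _ mt; have := sb _ mt'; move: rp; rewrite !goes_rightE //.
  move: om om' op or; rewrite /on_line => /eqP ? /eqP ? /eqP ? /eqP ?.
  by case: (odd k); case: (b) => /= ? ? ?; lra.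
have follow t' k' : (dominated t' p).1 = false ->
    ((dominated t' p).2 <= 6 * kd_depth k' t' p)%N ->
    exists2 c, child_dominated p t' (dominated t' p) = (false, c) &
      (c <= 2 + 6 * kd_depth k' t' p)%N.
  case: dominated => b c /= -> hc.
  case: t' hc => [|r' u' tl' tr'] hc /=; first by exists 0%N.
  by case: ifP => _; eexists; eauto; lia.
(* The factor 6: at each node of the path, 2 for its point and at most 2 for the upper bound of each
   child. *)
have [dl1 dl2] := IHl _ wfl ol; have [dr1 dr2] := IHr _ wfr orr.
case: (boolP (goes_right k r p)) => rp.
  rewrite (away _ true _ wfl ol) //; last by move=> q /wl/negbTE.
  have [c -> hc] := follow _ _ dr1 dr2 => /=; split=> //.
  by case: (tl) => [|? ? ? ?]; lia.
have [c -> hc] := follow _ _ dl1 dl2.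
rewrite (away _ false _ wfr orr) //=; last exact/negbTE.
by split => //; case: (tr) => [|? ? ? ?]; lia.
Qed.

(** For distinct keys this is the internal path length of the binary search tree built from [x]: the
    j-th key is an ancestor of the i-th exactly when no earlier key separates them. *)
Definition visible_pairs (x : seq R) : nat :=
  \sum_(i < size x) \sum_(j < i)
     ~~ has (strictly_between x`_j x`_i) (take j x).

Lemma kd_depth_build s p : all on_line s -> on_line p ->
  (kd_depth 0 (kd_build s) p <= \sum_(j < size s)
    ~~ has (strictly_between [seq key q | q <- s]`_j (key p))
          (take j [seq key q | q <- s]))%N.
Proof.
elim/last_ind: s => [|s q IH]; first by rewrite big_ord0.
rewrite all_rcons => /andP[oq os] op; rewrite kd_build_rcons size_rcons.
have obs : all on_line (kd_points (kd_build s)).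
  by rewrite (eq_all_r (mem_kd_build s)).
apply: leq_trans (kd_depth_insert (kd_build_wf s) obs op oq) _.
rewrite big_ord_recr /=; apply: leq_add.
  apply: leq_trans (IH os op) _; apply: leq_sum => j _.
  rewrite map_rcons nth_rcons size_map ltn_ord.
  by rewrite -cats1 takel_cat // size_map ltnW.
rewrite map_rcons nth_rcons size_map ltnn eqxx -cats1 takel_cat ?size_map //.
by rewrite take_oversize ?size_map // has_map (eq_has_r (mem_kd_build s)).
Qed.

(** No point is ever dominated, so all are inserted. The factor 9 is, per node of the path, 6 for
    the test plus [d.+1] = 3 for the insertion. *)
Lemma phase_on_line s : all on_line s ->
  exists2 c, phase s = (kd_build s, s, c) &
    (c <= 9 * visible_pairs [seq key q | q <- s])%N.
Proof.
elim/last_ind: s => [|s p IH]; first by exists 0%N.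
rewrite all_rcons => /andP[op os]; have [c sE hc] := IH os.
pose c1 := (dominated (kd_build s) p).2.
pose c2 := (kd_insert 0 (kd_build s) p).2.
have obs : all on_line (kd_points (kd_build s)).
  by rewrite (eq_all_r (mem_kd_build s)).
have [d1 d2] := dominated_on_line (kd_build_wf s) obs op.
exists (c + c1 + c2)%N.
  (* A step from the empty tree is free and yields a leaf, so the first point is no exception. *)
  have -> : phase (rcons s p) = phase_step (phase s) p.
    by case: (s) => //= p0 s'; rewrite foldl_rcons.
  rewrite sE /phase_step /c1 /c2 kd_build_rcons; move: d1.
  by case: dominated => b c' /= ->; case: kd_insert.
rewrite /c1 /c2 kd_insert_cost.
have {}hd := kd_depth_build os op.
rewrite /visible_pairs size_map size_rcons big_ord_recr /= mulnDr -addnA.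
apply: leq_add.
  apply: leq_trans hc _; rewrite leq_mul2l /= /visible_pairs size_map.
  apply: leq_sum => i _; apply: leq_sum => j _.
  rewrite map_rcons !nth_rcons size_map ltn_ord (ltn_trans (ltn_ord j)) //.
  by rewrite -cats1 takel_cat // size_map ltnW // (ltn_trans (ltn_ord j)).
apply: (@leq_trans (9 * kd_depth 0 (kd_build s) p)); first by lia.
rewrite leq_mul2l /=; apply: leq_trans hd _; apply: leq_sum => j _.
rewrite map_rcons !nth_rcons size_map ltn_ord ltnn eqxx.
by rewrite -cats1 takel_cat // size_map ltnW.
Qed.

(** All points survive phase 1, so phase 2 processes the whole input in reverse. *)
Lemma maxima_comparisons_on_line s : all on_line s ->
  (maxima_comparisons s <= 9 * (visible_pairs [seq key q | q <- s] +
                         visible_pairs [seq key q | q <- rev s]))%N.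
Proof.
move=> os; have ors : all on_line (rev s) by rewrite all_rev.
have [c1 e1 h1] := phase_on_line os; have [c2 e2 h2] := phase_on_line ors.
by rewrite /maxima_comparisons /maxima e1 e2 /=; lia.
Qed.

End Line.

(** * Measurability of finite conjunctions, and integrals of nonnegative functions *)

Section MeasureComplements.
Context d (T : measurableType d) (R : realType).

Lemma measurable_fun_forallb (I : finType) (b : I -> T -> bool) :
  (forall i, measurable_fun setT (b i)) ->
  measurable_fun setT (fun w => [forall i, b i w]).
Proof.
move=> mb; apply: (measurable_fun_bool true); rewrite setTI.
rewrite [X in measurable X](_ : _ =
    \bigcap_(i in [set: I]) (b i @^-1` [set true])).
  apply: fin_bigcap_measurable => // i _.
  by rewrite -[X in measurable X]setTI; exact: mb.
apply/seteqP; split => [w /= /forallP h i _|w /= h]; first exact: h.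
by apply/forallP => i; exact: h.
Qed.

Lemma measurable_setb (b : T -> bool) :
  measurable_fun setT b -> measurable [set w | b w].
Proof.
move=> mb; rewrite [X in measurable X](_ : _ = setT `&` b @^-1` [set true]).
  exact: mb.
by rewrite setTI.
Qed.

(* Unlike [ge0_le_integral], no measurability is needed: the integral of a
   nonnegative function is a supremum over the simple functions below it. *)
Lemma ge0_le_integral_nomeas (mu : {measure set T -> \bar R})
    (f g : T -> \bar R) : (forall w, 0 <= f w)%E ->
  (forall w, f w <= g w)%E -> (\int[mu]_w f w <= \int[mu]_w g w)%E.
Proof.
move=> f0 fg; have g0 w : (0 <= g w)%E by exact: le_trans (f0 w) (fg w).
rewrite !ge0_integralTE //; apply: ereal_sup_le => _ [h hf <-].
by exists h => // w; exact: le_trans (hf w) (fg w).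
Qed.

Lemma integral_sum_indic (mu : {measure set T -> \bar R}) (I : Type)
    (s : seq I) (F : I -> set T) : (forall i, measurable (F i)) ->
  (\int[mu]_w \sum_(i <- s) (\1_(F i) w)%:E = \sum_(i <- s) mu (F i))%E.
Proof.
move=> mF; rewrite ge0_integral_sum //.
- by apply: eq_bigr => i _; rewrite integral_indic // setIT.
- by move=> i; apply/measurable_EFinP; exact: measurable_indic.
Qed.

End MeasureComplements.

(** * Independent identically distributed families and exchangeability *)

Section IID.
Context d (T : measurableType d) (R : realType) (P : probability T R) (n : nat).
Implicit Types (Y Z : 'I_n -> T -> R) (D : set R -> \bar R).

(** The common law enters only through the product formula on rectangles, so [D] is a plain set
    function and permuted or negated families qualify at once. *)
Definition iid Y D : Prop := forall A : 'I_n -> set R,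
  (forall i, measurable (A i)) ->
  P (\bigcap_(i in [set: 'I_n]) (Y i @^-1` A i)) = (\prod_i D (A i))%E.

Definition joint Y (w : T) : n.-tuple R := [tuple Y i w | i < n].

Lemma measurable_joint Y : (forall i, measurable_fun setT (Y i)) ->
  measurable_fun setT (joint Y).
Proof.
move=> mY; apply/measurable_fun_tnthP => i.
rewrite [X in measurable_fun _ X](_ : _ = Y i) //.
by apply/funext => w /=; rewrite tnth_mktuple.
Qed.

(** Measurable rectangles are stable under intersection and generate the product sigma-algebra, so
    they determine a finite measure. *)
Lemma iid_joint_unique Y Z D :
  (forall i, measurable_fun setT (Y i)) ->
  (forall i, measurable_fun setT (Z i)) -> iid Y D -> iid Z D ->
  forall B : set (n.-tuple R), measurable B ->
  P (joint Y @^-1` B) = P (joint Z @^-1` B).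
Proof.
move=> mY mZ YD ZD B mB.
pose rect (A : 'I_n -> set R) : set (n.-tuple R) :=
  \bigcap_(i in [set: 'I_n]) ((@tnth n R ^~ i) @^-1` A i).
pose G := [set rect A | A in [set A | forall i, measurable (A i)]].
have jrect W A : joint W @^-1` rect A =
    \bigcap_(i in [set: 'I_n]) (W i @^-1` A i).
  apply/seteqP; split => w /= h i _.
    by have := h i I; rewrite /= tnth_mktuple.
  by rewrite /= tnth_mktuple; exact: h.
have mrect A : (forall i, measurable (A i)) -> measurable (rect A).
  move=> mA; apply: fin_bigcap_measurable => // i _.
  by rewrite -[X in measurable X]setTI; exact: measurable_tnth.
have GT : G setT.
  by exists (fun=> setT) => //; apply/seteqP; split.
pose hY : {mfun T >-> n.-tuple R} := HB.pack (joint Y)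
  (isMeasurableFun.Build _ _ _ _ _ (measurable_joint mY)).
pose hZ : {mfun T >-> n.-tuple R} := HB.pack (joint Z)
  (isMeasurableFun.Build _ _ _ _ _ (measurable_joint mZ)).
apply: (measure_unique G (fun=> setT) _ _ _ _
  (distribution P hY) (distribution P hZ) _ _ _ mB) => //.
- apply/seteqP; split; last first.
    apply: smallest_sub; first exact: sigma_algebra_measurable.
    by move=> _ [A mA <-]; exact: mrect.
  apply: smallest_sub; first exact: smallest_sigma_algebra.
  rewrite -bigcup_seq => C [i _ [A mA <-]]; apply: sub_sigma_algebra.
  (* The preimage of [A] under one coordinate is the rectangle whose other sides are full. *)
  exists (fun k => if k == i then A else setT).
    by move=> k /=; case: ifP.
  apply/seteqP; split => v /=; first by move/(_ i I); rewrite /= eqxx; split.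
  by move=> [_ Av] k _ /=; case: eqP => // ->.
- move=> _ _ [A mA <-] [A' mA' <-]; exists (fun i => A i `&` A' i).
    by move=> i; exact: measurableI.
  by rewrite /rect -bigcapI; apply: eq_bigcapr => i _; rewrite preimage_setI.
- by apply/seteqP; split => // v _; exists 0%N.
- move=> _ [A mA <-].
  change (P (joint Y @^-1` rect A) = P (joint Z @^-1` rect A)).
  by rewrite !jrect YD // ZD.
- by move=> _; rewrite (le_lt_trans (probability_le1 _ _)) ?ltry.
Qed.

Lemma iid_perm Y D (s : {perm 'I_n}) : iid Y D -> iid (fun i => Y (s i)) D.
Proof.
move=> YD A mA; rewrite [RHS](reindex_inj (@perm_inj _ s^-1%g)) /= -YD //.
congr (P _); apply/seteqP; split => w h i _ /=.
  by have := h ((s^-1)%g i) I; rewrite /= permKV.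
by have := h (s i) I; rewrite /= permK.
Qed.

Lemma iid_opp Y D :
  iid Y D -> iid (fun i w => - Y i w) (fun A => D (-%R @^-1` A)).
Proof.
move=> YD A mA; rewrite -YD // => i.
by rewrite -[X in measurable X]setTI; exact: (@oppr_measurable R).
Qed.

(** The rectangle with sides [A] and [B] at [i] and [j] and full sides elsewhere. *)
Lemma iid_pair Y D i j (A B : set R) : iid Y D -> D setT = 1%E -> i != j ->
  measurable A -> measurable B ->
  P (Y i @^-1` A `&` Y j @^-1` B) = (D A * D B)%E.
Proof.
move=> YD D1 ij mA mB.
pose C k := if k == i then A else if k == j then B else setT.
have := YD C; rewrite (bigD1 i) //= (bigD1 j) 1?eq_sym //=.
rewrite big1 ?mule1; last first.
  by move=> k /andP[/negbTE ki /negbTE kj]; rewrite /C ki kj.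
have Ci : C i = A by rewrite /C eqxx.
have Cj : C j = B by rewrite /C eq_sym (negbTE ij) eqxx.
rewrite Ci Cj => <-; last by move=> k; rewrite /C; case: ifP => // _; case: ifP.
congr (P _); apply/seteqP; split => [w [/= Aw Bw] k _|w h].
  by rewrite /C /=; case: eqP => [->//|_]; case: eqP => [->|].
by split; [rewrite -Ci|rewrite -Cj]; exact: h.
Qed.

(** The weak inequality lets a tie disqualify both candidates, which keeps the events for distinct
    [m] disjoint without assuming distinct values. *)
Definition nearest_below (J : {set 'I_n}) (i m : 'I_n) (y : 'I_n -> R) : bool :=
  (y m < y i) && [forall k, (k \in J) && (k != m) ==> ~~ (y m <= y k < y i)].

(** The transposition preserves [J] and fixes [i], which lies outside it, so it only exchanges the
    two candidates. *)
Lemma nearest_below_tperm (J : {set 'I_n}) i m m' (y : 'I_n -> R) :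
    i \notin J -> m \in J -> m' \in J ->
  nearest_below J i m (y \o tperm m m') = nearest_below J i m' y.
Proof.
move=> iJ mJ mJ'; rewrite /nearest_below /= tpermL tpermD; last 2 first.
- by apply: contraNneq iJ => <-.
- by apply: contraNneq iJ => <-.
have inJ k : (tperm m m' k \in J) = (k \in J).
  by case: tpermP => // ->; rewrite mJ mJ'.
have neq k : (tperm m m' k != m') = (k != m).
  by rewrite -(inj_eq (@perm_inj _ (tperm m m'))) tpermK tpermR.
congr andb; apply/forallP/forallP => h k.
  by have := h (tperm m m' k); rewrite tpermK inJ -(neq (tperm _ _ k)) tpermK.
by have := h (tperm m m' k); rewrite inJ neq.
Qed.

Lemma measurable_nearest_below d' (T' : measurableType d') J i m
    (Z : 'I_n -> T' -> R) : (forall k, measurable_fun setT (Z k)) ->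
  measurable [set w | nearest_below J i m (Z^~ w)].
Proof.
move=> mZ; apply: measurable_setb; apply: measurable_and.
  exact: measurable_fun_ltr.
apply: measurable_fun_forallb => k; under eq_fun do rewrite implybE.
apply: measurable_or; first exact: measurable_cst.
apply: measurable_neg; apply: measurable_and.
  exact: measurable_fun_ler.
exact: measurable_fun_ltr.
Qed.

(* The events obtained by letting m range over J are disjoint and, by
   exchangeability, equiprobable. *)
Lemma nearest_below_prob Y D (J : {set 'I_n}) (i m : 'I_n) :
    (forall k, measurable_fun setT (Y k)) -> iid Y D -> i \notin J -> m \in J ->
  (P [set w | nearest_below J i m (Y^~ w)] <= (#|J|%:R^-1)%:E)%E.
Proof.
move=> mY YD iJ mJ; pose E m := [set w | nearest_below J i m (Y^~ w)].
have mE k : measurable (E k) by exact: measurable_nearest_below.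
have PE k : k \in J -> P (E k) = P (E m).
  (* Written as a preimage under the joint vector, the event has the same probability for the
     transposed family. *)
  move=> kJ; pose B := [set v : n.-tuple R | nearest_below J i m (tnth v)].
  have mB : measurable B.
    exact: (measurable_nearest_below J i m (@measurable_tnth _ R n)).
  have jB Z : joint Z @^-1` B = [set w | nearest_below J i m (Z^~ w)].
    have jE w : tnth (joint Z w) =1 Z^~ w by move=> l; rewrite tnth_mktuple.
    by apply/seteqP; split => w; rewrite /B /= (funext (jE w)).
  have mYs l : measurable_fun setT (Y (tperm m k l)) by exact: mY.
  have := iid_joint_unique mY mYs YD (iid_perm (tperm m k) YD) mB.
  rewrite !jB => ->; congr (P _); apply/seteqP; split => w;
    by rewrite /E /= -(nearest_below_tperm (Y^~ w) iJ mJ kJ).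
(* Two distinct nearest candidates would each be strictly below the other. *)
have tE : trivIset [set k | k \in J] E.
  move=> k l kJ lJ [w []]; rewrite /E /nearest_below /=.
  move=> /andP[ki /forallP hk] /andP[li /forallP hl].
  apply/eqP; apply: contraT => kl.
  have lk : l != k by rewrite eq_sym.
  have := hk l; have := hl k.
  rewrite (kJ : k \in J) (lJ : l \in J) kl lk /= ki li !andbT.
  by rewrite -!ltNge => h1 h2; have := lt_trans h1 h2; rewrite ltxx.
have mU : measurable (\big[setU/set0]_(k < n | k \in J) E k).
  exact: bigsetU_measurable.
have := probability_le1 P mU.
rewrite measure_bigsetU_ord_cond // (eq_bigr (fun=> P (E m))) //.
rewrite -/(E m) -[P (E m)]fineK ?fin_num_measure // sumEFin sumr_const.
have J0 : (0 < #|J|)%N by apply/card_gt0P; exists m.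
rewrite -[1%E]/(1%:E) !lee_fin => h.
by rewrite -div1r ler_pdivlMr ?ltr0n // mulr_natr.
Qed.

End IID.

(** * Ties between independent points have probability zero *)

Lemma unit_cell (R : realType) (N : nat) (x : R) : 0 <= x <= 1 ->
  exists2 k, (k < N.+1)%N & k%:R / N.+1%:R <= x <= k.+1%:R / N.+1%:R.
Proof.
move=> /andP[x0 x1]; have N0 : (0 : R) < N.+1%:R by [].
have y0 : 0 <= x * N.+1%:R by rewrite mulr_ge0.
have [lN|Nl] := ltnP (Num.trunc (x * N.+1%:R)) N.+1.
  exists (Num.trunc (x * N.+1%:R)) => //.
  have /andP[h1 h2] := truncn_itv y0.
  by rewrite ler_pdivrMr // h1 ler_pdivlMr // ltW.
(* Only [x] = 1 remains; it goes into the last cell. *)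
exists N => //; rewrite divff ?gt_eqF // x1 andbT ler_pdivrMr //.
have /andP[h1 _] := truncn_itv y0.
by apply: le_trans h1; rewrite ler_nat (leq_trans _ Nl).
Qed.

(** The diagonal of the unit square is covered by N + 1 squares of side 1 / (N + 1), each of
    probability at most 1 / (N + 1)^2. The total 1 / (N + 1) is arbitrarily small. *)
Lemma iid_tie_prob d (T : measurableType d) (R : realType)
    (P : probability T R) (n : nat) (Y : 'I_n -> T -> R) D i j :
    (forall k, measurable_fun setT (Y k)) -> iid P Y D -> D setT = 1%E ->
    (forall A, (0 <= D A)%E) ->
    D (~` `[0, 1]) = 0%E ->
    (forall a b, a <= b -> (D `[a, b]%classic <= (b - a)%:E)%E) ->
  i != j -> P [set w | Y i w = Y j w] = 0%E.
Proof.
move=> mY YD D1 Dge0 D0 Dle ij; pose tie := [set w | Y i w = Y j w].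
have mtie : measurable tie.
  rewrite [tie](_ : _ = [set w | Y i w == Y j w]).
    by apply: measurable_setb; exact: measurable_fun_eqr.
  by apply/seteqP; split => w /= /eqP.
have tieN N : (P tie <= (N.+1%:R^-1)%:E)%E.
  (* Index [N.+1] stands for the complement of the unit interval, a null set, so that a single
     finite union covers all ties. *)
  pose A k : set R := if (k < N.+1)%N
    then `[k%:R / N.+1%:R, k.+1%:R / N.+1%:R]%classic else ~` `[0, 1].
  have mA k : measurable (A k).
    by rewrite /A; case: ifP => // _; exact: measurableC.
  have AN : A N.+1 = ~` `[0, 1] by rewrite /A ltnn.
  pose F k := Y i @^-1` A k `&` Y j @^-1` A k.
  have mF k : measurable (F k).
    by apply: measurableI; rewrite -[X in measurable X]setTI; exact: mY.
  have tieF : tie `<=` \big[setU/set0]_(k < N.+2) F k.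
    move=> w; rewrite /tie /= => wij; rewrite -bigcup_mkord.
    have [x01|x01] := boolP (0 <= Y i w <= 1).
      have [k kN xk] := unit_cell N x01; exists k; first exact: (ltn_trans kN).
      by rewrite /F /A kN /= in_itv /= -wij.
    exists N.+1; first exact: ltnSn.
    by rewrite /F AN /= in_itv /= -wij; split; exact/negP.
  apply: (le_trans (content_subadditive P (fun k _ => mF k) mtie tieF)).
  rewrite big_ord_recr /= [X in (_ + X)%E](_ : _ = 0%E); last first.
    by rewrite /F (iid_pair YD D1 ij) // AN D0 mul0e.
  rewrite adde0.
  apply: (@le_trans _ _
    (\sum_(k < N.+1) ((N.+1%:R^-1 * N.+1%:R^-1)%:E : \bar R))%E).
    apply: lee_sum => k _; rewrite /F (iid_pair YD D1 ij) // EFinM.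
    have dk : (k.+1%:R / N.+1%:R - k%:R / N.+1%:R = N.+1%:R^-1 :> R).
      by rewrite -mulrBl -natr1 addrAC subrr add0r mul1r.
    have Dk : (D (A k) <= (N.+1%:R^-1)%:E)%E.
      rewrite /A ltn_ord -[X in (_ <= X%:E)%E]dk; apply: Dle.
      by rewrite ler_pM2r // ler_nat.
    exact: lee_pmul.
  rewrite sumEFin sumr_const card_ord lee_fin -[leLHS]mulr_natr -mulrA.
  by rewrite mulVf ?mulr1 ?pnatr_eq0.
apply/eqP; rewrite eq_le measure_ge0 andbT.
have fP : P tie \is a fin_num by rewrite fin_num_measure.
rewrite -(fineK fP) lee_fin leNgt; apply/negP => /ltr_add_invr[N].
rewrite add0r => h; have := tieN N; rewrite -(fineK fP) lee_fin leNgt.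
by rewrite h.
Qed.

(** * The uniform law on the unit interval *)

Section Uniform.
Context (R : realType).
Local Notation unif := (uniform_prob (@ltr01 R)).

(** The density is at most 1. *)
Lemma uniform_prob_le_lebesgue (A : set R) : measurable A ->
  (unif A <= lebesgue_measure A)%E.
Proof.
move=> mA; rewrite /uniform_prob.
rewrite -[leRHS]mul1e -(@integral_cst _ _ _ lebesgue_measure) //.
apply: ge0_le_integral => //.
- by move=> x _; rewrite lee_fin uniform_pdf_ge0.
- by apply/measurable_EFinP/measurable_funTS; exact: measurable_uniform_pdf.
- move=> x _; rewrite lee_fin /uniform_pdf subr0 invr1.
  by case: ifP.
Qed.

Lemma uniform_prob_itvcc (a b : R) : a <= b ->
  (unif `[a, b]%classic <= (b - a)%:E)%E.
Proof.
move=> ab; apply: le_trans (uniform_prob_le_lebesgue _) _ => //.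
rewrite lebesgue_measure_itv /= lte_fin; case: ifP => _.
  by rewrite -EFinD.
by rewrite lee_fin subr_ge0.
Qed.

Lemma uniform_prob_unitC : unif (~` `[0, 1]) = 0%E.
Proof. by rewrite /uniform_prob integral_uniform_pdf setICl integral_set0. Qed.

End Uniform.

(** * From visible pairs to nearest-neighbour events *)

Section Counting.
Context (R : realType) (n : nat).
Implicit Types y : 'I_n -> R.

Definition visible_event y (p : 'I_n * 'I_n) : bool :=
  (p.2 < p.1)%N && nearest_below [set k : 'I_n | (k <= p.2)%N]%SET p.1 p.2 y.

(** An unseparated key is the nearest to [y i], from below or from above, among those of index at
    most [j]; negation turns above into below. Injectivity bridges strict betweenness and the weak
    inequality in [nearest_below]. *)
Lemma visible_pairs_le y : injective y ->
  (visible_pairs [seq y i | i <- enum 'I_n] <=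
   \sum_(p : 'I_n * 'I_n) visible_event y p +
   \sum_(p : 'I_n * 'I_n) visible_event (fun i => - y i) p)%N.
Proof.
move=> yI; rewrite /visible_pairs size_map size_enum_ord -big_split /=.
rewrite -(pair_bigA _ (fun i j => visible_event y (i, j) +
  visible_event (fun k => - y k) (i, j))%N) /=.
apply: leq_sum => i _; rewrite [leqRHS](bigID (fun j : 'I_n => (j < i)%N)) /=.
apply: leq_trans (leq_addr _ _).
have nthy (k : 'I_n) : [seq y i | i <- enum 'I_n]`_k = y k.
  by rewrite (nth_map k) ?size_enum_ord // nth_ord_enum.
rewrite (big_ord_widen_cond n predT (fun j => ~~ has (strictly_between
  [seq y i | i <- enum 'I_n]`_j [seq y i | i <- enum 'I_n]`_i)
  (take j [seq y i | i <- enum 'I_n]) : nat)) /=; last exact: ltnW.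
apply: leq_sum => j ji; rewrite !nthy /visible_event /= ji /=.
case: hasPn => //= hs; rewrite addn_gt0 !lt0b.
have hk (k : 'I_n) : (k <= j)%N -> k != j ->
    ~~ strictly_between (y j) (y i) (y k).
  move=> kj kNj; have {}kj : (k < j)%N by rewrite ltn_neqAle kNj.
  apply: hs; rewrite -nthy -(nth_take _ kj) mem_nth //.
  by rewrite size_take size_map size_enum_ord ltn_ord.
have yN (k l : 'I_n) : k != l -> y k != y l by rewrite (inj_eq yI).
have ij : i != j by apply: contraTneq ji => ->; rewrite ltnn.
apply/orP; have := yN _ _ ij; rewrite neq_lt => /orP[yij|yji]; [right|left].
  rewrite /nearest_below ltrN2 yij; apply/forallP => k; rewrite inE.
  apply/implyP => /andP[kj kNj]; have := hk _ kj kNj; have := yN _ _ kNj.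
  by rewrite /strictly_between !lerN2 ltrN2 neq_lt; lra.
rewrite /nearest_below yji; apply/forallP => k; rewrite inE.
apply/implyP => /andP[kj kNj]; have := hk _ kj kNj; have := yN _ _ kNj.
by rewrite /strictly_between neq_lt; lra.
Qed.

End Counting.

Lemma harmonic_sum_le (R : realType) (n : nat) :
  \sum_(j < n.+1) (j.+1%:R^-1 : R) <= 1 + ln n.+1%:R.
Proof.
elim: n => [|n IH]; first by rewrite big_ord1 ln1 addr0 invr1.
rewrite big_ord_recr /=; apply: le_trans (lerD IH (lexx _)) _.
rewrite -addrA lerD2l.
have n1 : (0 : R) < n.+1%:R by []. have n2 : (0 : R) < n.+2%:R by [].
(* The bound ln (1 + x) <= x at x = -1 / (n + 2) gives ln (n + 1) - ln (n + 2) <= -1 / (n + 2). *)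
have := @le_ln1Dx R (- n.+2%:R^-1).
rewrite ltrN2 invf_lt1 ?ltr1n // => /(_ isT).
have -> : 1 - n.+2%:R^-1 = n.+1%:R / n.+2%:R :> R.
  apply: (@mulIf _ n.+2%:R); first by rewrite gt_eqF.
  by rewrite mulrBl mul1r mulVf ?divfK ?gt_eqF // -[n.+2%:R]natr1 addrK.
rewrite ln_div ?posrE //.
by move: (ln _) (ln _) (_^-1) => a b c; lra.
Qed.

(* The sign picks the neighbour above or below, the order the phase. *)
Definition arranged (R : zmodType) (n : nat) (y : 'I_n -> R) (neg rv : bool)
    (i : 'I_n) : R :=
  let v := y (if rv then rev_ord i else i) in if neg then - v else v.

(** * Probability of visibility over both signs and both insertion orders *)

Section Arranged.
Context d (T : measurableType d) (R : realType) (P : probability T R) (n : nat).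
Variables (Y : 'I_n -> T -> R) (D : set R -> \bar R).
Hypotheses (mY : forall i, measurable_fun setT (Y i)) (YD : iid P Y D).

Let Z neg rv i w := arranged (Y ^~ w) neg rv i.

Lemma measurable_arranged neg rv i : measurable_fun setT (Z neg rv i).
Proof.
rewrite /Z /arranged; case: neg => //.
exact: (measurableT_comp (@oppr_measurable R _) (mY _)).
Qed.

(** The common law is [D] or its reflection; [nearest_below_prob] accepts either. *)
Lemma iid_arranged neg rv : exists D', iid P (Z neg rv) D'.
Proof.
have YrD : iid P (fun i => Y (if rv then rev_ord i else i)) D.
  case: rv => //.
  have -> : (fun i => Y (rev_ord i)) =
      (fun i => Y (perm (@rev_ord_inj n) i)).
    by apply/funext => i; rewrite permE.
  exact: iid_perm.
by case: neg; eexists; [exact: iid_opp YrD|exact: YrD].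
Qed.

Definition visible_set (t : (bool * bool) * ('I_n * 'I_n)) : set T :=
  [set w | visible_event (arranged (Y ^~ w) t.1.1 t.1.2) t.2].

Lemma measurable_visible_set t : measurable (visible_set t).
Proof.
rewrite /visible_set /visible_event; case: (_ < _)%N => /=.
  exact: (measurable_nearest_below _ _ _ (measurable_arranged t.1.1 t.1.2)).
by rewrite [X in measurable X](_ : _ = set0) //; apply/seteqP; split.
Qed.

(** For each of the 4 choices of sign and order and each of the [n] values of i, the pair (i, j)
    contributes at most 1 / (j + 1). *)
Lemma sum_visible_set :
  (\sum_t P (visible_set t) <=
    (4 * (n%:R * \sum_(j < n) (j.+1%:R^-1 : R)))%:E)%E.
Proof.
rewrite -(pair_bigA _ (fun b p => P (visible_set (b, p)))) /=.
have card4 : #|{: bool * bool}| = 4%N by rewrite card_prod card_bool.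
apply: (@le_trans _ _ (\sum_(b : bool * bool)
    (n%:R * \sum_(j < n) (j.+1%:R^-1 : R))%:E)%E); last first.
  by rewrite sumEFin sumr_const card4 lee_fin -[leLHS]mulr_natl.
apply: lee_sum => -[neg rv] _.
rewrite -(pair_bigA _ (fun i j => P (visible_set ((neg, rv), (i, j))))) /=.
apply: (@le_trans _ _ (\sum_(i < n)
    (\sum_(j < n) (j.+1%:R^-1 : R))%:E)%E); last first.
  by rewrite sumEFin sumr_const card_ord lee_fin -[leLHS]mulr_natl.
apply: lee_sum => i _; rewrite -sumEFin; apply: lee_sum => j _.
rewrite /visible_set /visible_event /=; have [ji|_] /= := ltnP j i; last first.
  rewrite [X in P X](_ : _ = set0) ?measure0 ?lee_fin ?invr_ge0 //.
  by apply/seteqP; split.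
have [D' hD'] := iid_arranged neg rv.
set J := [set k | _]%SET.
(* The candidates are the indices 0 to [j], including [j] itself. *)
have -> : j.+1 = #|J|.
  rewrite -sum1_card (eq_bigl (fun k : 'I_n => (k < j.+1)%N)); last first.
    by move=> k; rewrite inE.
  by rewrite (big_ord_narrow (ltn_ord j)) sum1_card card_ord.
apply: (nearest_below_prob (measurable_arranged neg rv) hD').
  by rewrite inE -ltnNge.
by rewrite inE.
Qed.

End Arranged.

(** The order bit separates the two phases, the sign bit the neighbours below and above. *)
Lemma maxima_comparisons_visible (R : realType) (n : nat)
    (x : 'I_n -> 2.-tuple R) :
    (forall i, on_line (x i)) -> injective (fun i => key (x i)) ->
  (maxima_comparisons [seq x i | i <- enum 'I_n] <=
   9 * \sum_(t : (bool * bool) * ('I_n * 'I_n))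
     visible_event (arranged (fun i => key (x i)) t.1.1 t.1.2) t.2)%N.
Proof.
move=> xl xI; set s := map x _.
have sl : all on_line s by apply/allP => _ /mapP[i _ ->].
apply: leq_trans (maxima_comparisons_on_line sl) _; rewrite leq_mul2l /=.
have -> : [seq key q | q <- s] = [seq key (x i) | i <- enum 'I_n].
  by rewrite -map_comp.
have -> : [seq key q | q <- rev s] = [seq key (x (rev_ord i)) | i <- enum 'I_n].
  rewrite map_rev -map_comp; apply: (@eq_from_nth _ 0).
    by rewrite size_rev !size_map.
  rewrite size_rev size_map size_enum_ord => i ni.
  rewrite nth_rev size_map size_enum_ord //.
  have i0 : 'I_n by exact: Ordinal ni.
  have ni' : (n - i.+1 < n)%N by rewrite ltn_subrL (leq_trans _ ni).
  rewrite !(nth_map i0) -?enumT ?size_enum_ord //.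
  by congr (key (x _)); apply/val_inj => /=; rewrite !nth_enum_ord.
apply: leq_trans (leq_add (visible_pairs_le xI) (visible_pairs_le _)) _.
  by move=> i j /xI; exact: rev_ord_inj.
pose y i := key (x i).
rewrite -(pair_bigA _ (fun b p => nat_of_bool
  (visible_event (arranged y b.1 b.2) p))) /=.
rewrite -(pair_bigA _ (fun b c => \sum_p nat_of_bool
  (visible_event (arranged y b c) p))%N) /=.
rewrite !big_bool /arranged /=.
rewrite [leqRHS]addnACA [leqRHS]addnC.
by rewrite [X in (_ <= X + _)%N]addnC [X in (_ <= _ + X)%N]addnC leqnn.
Qed.

(** * Expected number of comparisons *)

Section Expectation.
Context d (T : measurableType d) (R : realType) (P : probability T R) (n : nat).
Variable X : 'I_n -> {RV P >-> 2.-tuple R}.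
Hypothesis Xind : mutually_independent X.
Hypothesis Xunif : forall i, uniform_on_simplex1 (X i).

Let Y i w := key (X i w).
Let D : set R -> \bar R := uniform_prob (@ltr01 R).

Let mY i : measurable_fun setT (Y i).
Proof.
by apply: (measurableT_comp (measurable_tnth 0)); exact: measurable_funPT.
Qed.

Let mtnth0 (A : set R) : measurable A ->
  measurable [set p : 2.-tuple R | A (key p)].
Proof.
by move=> mA; rewrite -[X in measurable X]setTI; exact: measurable_tnth.
Qed.

Let YD : iid P Y D.
Proof.
move=> A mA; have -> : (\prod_i D (A i) =
    \prod_(i in [set: 'I_n]%SET) P (X i @^-1` [set p | A i (key p)]))%E.
  apply: eq_big => [i|i _]; first by rewrite inE.
  (* The key of [simplex1_param x] computes to [x], so the pulled-back set is [A i] itself. *)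
  exact/esym/(Xunif i (mtnth0 (mA i))).
rewrite -Xind; last by move=> i _; exact: mtnth0.
by congr (P _); apply/seteqP; split => w h i _; apply: h => //=; rewrite inE.
Qed.

Let mline : measurable [set p : 2.-tuple R | on_line p].
Proof.
apply: measurable_setb; apply: measurable_fun_eqr => //.
by apply: measurable_funD; exact: measurable_tnth.
Qed.

Let moff i : measurable [set w | ~~ on_line (X i w)].
Proof.
rewrite [X in measurable X](_ : _ = X i @^-1` (~` [set p | on_line p])).
  rewrite -[X in measurable X]setTI; apply: measurable_funPT => //.
  exact: measurableC.
by apply/seteqP; split => w /= /negP.
Qed.

Lemma off_line_prob i : P [set w | ~~ on_line (X i w)] = 0%E.
Proof.
have := Xunif i (measurableC mline); rewrite /distribution /uniform_simplex1.
rewrite /pushforward => h.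
transitivity (P (X i @^-1` (~` [set p | on_line p]))).
  by congr (P _); apply/seteqP; split => w /= /negP.
rewrite h [X in uniform_prob _ X](_ : _ = set0) ?measure0 //.
apply/seteqP; split => // x /=; apply; rewrite /on_line /simplex1_param.
by rewrite !(tnth_nth 0) /= addrC subrK.
Qed.

(** Outside a null set the deterministic bound applies pointwise; 36 is its factor 9 times the 4 of
    [sum_visible_set]. *)
Lemma expected_comparisons_le :
  ('E_P[fun w => (maxima_comparisons [seq X i w | i <- enum 'I_n])%:R] <=
    (36 * (n%:R * \sum_(j < n) (j.+1%:R^-1 : R)))%:E)%E.
Proof.
(* Diagonal indices record a point off the line, the others a tie of first coordinates. *)
pose bad (p : 'I_n * 'I_n) := if p.1 == p.2 then [set w | ~~ on_line (X p.1 w)]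
  else [set w | Y p.1 w = Y p.2 w].
pose N := \big[setU/set0]_p bad p.
have [mN N0] : measurable N /\ P N = 0%E.
  rewrite /N; elim/big_ind : _ => [|A B [mA A0] [mB B0]|[i j] _].
  - by rewrite measure0.
  - by split; [exact: measurableU|rewrite measureU0].
  - rewrite /bad /=; case: eqVneq => ij.
      by split; [exact: moff|exact: off_line_prob].
    split; last first.
      apply: (iid_tie_prob mY YD) => //.
      + exact: probability_setT.
      + exact: uniform_prob_unitC.
      + exact: uniform_prob_itvcc.
    rewrite [X in measurable X](_ : _ = [set w | Y i w == Y j w]).
      by apply: measurable_setb; exact: measurable_fun_eqr.
    by apply/seteqP; split => w /= /eqP.
pose F (w : T) : \bar R := (\sum_t (\1_(visible_set Y t) w)%:E)%E.
have mind t :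
    measurable_fun setT (fun w => (\1_(visible_set Y t) w)%:E : \bar R).
  by apply/measurable_EFinP/measurable_indic/measurable_visible_set.
have F0 w : (0 <= F w)%E by apply: sume_ge0 => t _; rewrite lee_fin.
have mF : measurable_fun setT F by exact: emeasurable_sum.
rewrite unlock.
(* The value +oo on [N] makes the bound hold everywhere and integrates to 0, as [N] is null. *)
apply: (@le_trans _ _ (\int[P]_w (9%:E * F w + (cst +oo%E \_ N) w))%E).
  apply: ge0_le_integral_nomeas => w; first by rewrite lee_fin.
  have F9 : (0 <= 9%:E * F w)%E by rewrite mule_ge0 // lee_fin.
  rewrite patchE; case: ifPn => [_|].
    by rewrite addey ?leey // gt_eqF // (lt_le_trans _ F9).
  rewrite notin_setE /N -bigcup_seq => wN; rewrite adde0.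
  have wbad p : ~ bad p w.
    by move=> pw; apply: wN; exists p => //=; rewrite mem_index_enum.
  have wl i : on_line (X i w).
    by have := wbad (i, i); rewrite /bad /= eqxx /= => /negP; rewrite negbK.
  have wI : injective (Y ^~ w).
    move=> i j Yij; apply/eqP; apply: contraT => ij.
    by have := wbad (i, j); rewrite /bad /= (negbTE ij).
  have := maxima_comparisons_visible wl wI.
  rewrite -(ler_nat R) natrM natr_sum => h.
  rewrite /F sumEFin -EFinM lee_fin (le_trans h) // ler_wpM2l //.
  apply: ler_sum => t _; rewrite indicE /visible_set.
  by rewrite mem_setE.
rewrite ge0_integralD //; last 4 first.
- by move=> w _; rewrite mule_ge0 // lee_fin.
- exact: measurable_funeM.
- by move=> w _; rewrite patchE; case: ifP => _ /=; rewrite ?leey.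
- apply/(measurable_restrictT _ _).1 => //.
rewrite -(integral_mkcond N (cst +oo%E)) integral_cst //. 
rewrite [X in (+oo * X)%E]N0 mule0 adde0.
rewrite ge0_integralZl //.
rewrite integral_sum_indic; last exact: measurable_visible_set.
apply: (@le_trans _ _
    (9%:E * (4 * (n%:R * \sum_(j < n) (j.+1%:R^-1 : R)))%:E)%E).
  apply: lee_wpmul2l; first by rewrite lee_fin.
  exact: (sum_visible_set mY YD).
by rewrite -EFinM lee_fin; lra.
Qed.

End Expectation.

Theorem theorem3 (R : realType) :
  exists C : R, \forall n \near \oo,
    forall (disp : measure_display) (T : measurableType disp)
           (P : probability T R) (X : 'I_n -> {RV P >-> 2.-tuple R}),
      mutually_independent X ->
      (forall i : 'I_n, uniform_on_simplex1 (X i)) ->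
      ('E_P[fun w => (maxima_comparisons [seq X i w | i <- enum 'I_n])%:R]
         <= (C * (n%:R * ln n%:R))%:E)%E.
Proof.
(* For n >= 2, ln n >= ln 2 > 0, so 1 + ln n <= (1 / ln 2 + 1) ln n. *)
exists (36 * ((ln 2)^-1 + 1)); exists 2%N => // -[//|n] /= n2.
move=> disp T P X Xind Xunif.
apply: le_trans (expected_comparisons_le Xind Xunif) _; rewrite lee_fin.
rewrite -mulrA ler_pM2l // mulrCA ler_pM2l ?ltr0n //.
apply: le_trans (harmonic_sum_le R n) _.
have ln2 : (0 : R) < ln 2 by rewrite ln_gt0 // ltr1n.
rewrite mulrDl mul1r lerD2r mulrC ler_pdivlMr // mul1r.
by rewrite ler_ln ?posrE ?ltr0n // ler_nat.
Qed.
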